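(* Let $\lambda\in\mathbb{R}\setminus\{0\}$ and let $(\Omega,\cdot)$ be a commutative semigroup; or let $\lambda=0$ and let $\Omega$ be a set. Then $(\mathcal{F}_\Omega,\sqcup\!\sqcup_\lambda,\emptyset)$ is a nonassociative, commutative, unital algebra.
   Context: ''Nonassociative algebra'' means a real vector space with a bilinear product for which associativity is not assumed; here $\emptyset$ is the unit. A rooted forest is a finite (possibly empty) disjoint union of finite (non-planar) rooted trees; an $\Omega$-decorated forest carries a map from its vertex set to $\Omega$; forests are taken up to isomorphism. $\mathcal{F}_\Omega$ is the commutative unital $\mathbb{R}$-algebra freely generated by nonempty $\Omega$-decorated rooted trees: its product is concatenation (disjoint union), its unit the empty forest $\emptyset$, and forests form a basis. $|F|$ is the number of vertices of $F$. $B_+^\omega(F)$ is the tree obtained from $F$ by adding a new root decorated by $\omega$ joined to every root of $F$ (extended linearly in $F$). $\lambda$-shuffle of trees: the bilinear product $\sqcup\!\sqcup_\lambda$ on $\mathcal{F}_\Omega$ is defined on forests by recursion on $|F|+|F'|$: (i) $\emptyset\sqcup\!\sqcup_\lambda F=F\sqcup\!\sqcup_\lambda\emptyset=F$; (ii) if $F=T_1\cdots T_k$, $F'=t_1\cdots t_n$ with all $T_i,t_j$ nonempty trees, $k,n\ge1$, $k+n\ge3$: $F\sqcup\!\sqcup_\lambda F'=\frac1{kn}\sum_{i=1}^k\sum_{j=1}^n(T_i\sqcup\!\sqcup_\lambda t_j)\,T_1\cdots\widehat{T_i}\cdots T_k\,t_1\cdots\widehat{t_j}\cdots t_n$ (hats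 denote omission); (iii) if $T=B_+^a(f)$, $T'=B_+^{a'}(f')$: $T\sqcup\!\sqcup_\lambda T'=B_+^a(f\sqcup\!\sqcup_\lambda T')+B_+^{a'}(T\sqcup\!\sqcup_\lambda f')+\lambda B_+^{a\cdot a'}(f\sqcup\!\sqcup_\lambda f')$, the last term being absent when $\lambda=0$. *)

(* Defs.v *)
From Stdlib Require List.
From HB Require Import structures.
From mathcomp Require Import all_boot all_order all_algebra.
From mathcomp Require Import generic_quotient finmap.
From mathcomp Require Import boolp reals zify.
From mathcomp.multinomials Require Import monalg.
Set Implicit Arguments.
Unset Strict Implicit.
Unset Printing Implicit Defensive.
Import GRing.Theory.
Local Open Scope ring_scope.
Local Open Scope quotient_scope.

(* Planar representatives of non-planar rooted trees: a root decoration and the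
   list of subtrees hanging from the root. *)
Inductive ptree (Omega : Type) : Type :=
  PNode of Omega & seq (ptree Omega).

Section Planar.
Variable Omega : Type.

(* Decorations form an arbitrary set, so decidable equality and choice come
   from classical logic. *)
HB.instance Definition _ := gen_eqMixin (ptree Omega).
HB.instance Definition _ := gen_choiceMixin (ptree Omega).

(* Isomorphism of decorated rooted trees: same root decoration, and the
   subtrees at the root are pairwise isomorphic up to reordering. *)
Inductive ptree_iso : ptree Omega -> ptree Omega -> Prop :=
  PIso a s u s' : perm_eq s u -> List.Forall2 ptree_iso u s' ->
    ptree_iso (PNode a s) (PNode a s').

Definition proot (t : ptree Omega) : Omega := let: PNode a _ := t in a.

Definition pchildren (t : ptree Omega) : seq (ptree Omega) :=
  let: PNode _ s := t in s.

Fixpoint psize (t : ptree Omega) : nat :=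
  let: PNode _ s := t in (sumn (map psize s)).+1.

Lemma ptree_size_ind (P : ptree Omega -> Prop) :
  (forall a s, (forall t, t \in s -> P t) -> P (PNode a s)) -> forall t, P t.
Proof.
move=> IH t; have [n] := ubnP (psize t); elim: n t => // n IHn [a s] /=; rewrite ltnS => le.
apply: IH => t ts; apply: IHn; apply: leq_trans _ le.
rewrite ltnS; elim: s ts => //= x s IHs; rewrite inE => /orP[/eqP->|/IHs le].
  exact: leq_addr.
exact: leq_trans le (leq_addl _ _).
Qed.

Lemma Forall2_perm (A B : eqType) (r : A -> B -> Prop) (u v : seq A)
    (s : seq B) :
  perm_eq u v -> List.Forall2 r u s ->
  exists2 w, perm_eq s w & List.Forall2 r v w.
Proof.
elim: v u s => [|x v IH] u s.
  by move=> /perm_nilP-> h; inversion h; exists [::].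
move=> puv us; have : x \in u by rewrite (perm_mem puv) mem_head.
move=> xu; move: puv us; case/splitPr: xu => u1 u2 puv us.
have [s1 [s2 [us1 [us2 ->]]]] := List.Forall2_app_inv_l _ _ us.
inversion us2 as [|? y ? s2' rxy us2' e1 e2]; subst.
have puv' : perm_eq (u1 ++ u2) v.
  by rewrite -(perm_cons x) -(permPr puv) -cat1s perm_catCA.
have [w pw vw] := IH _ (s1 ++ s2') puv' (List.Forall2_app us1 us2').
exists (y :: w); last by constructor.
by rewrite -cat1s perm_catCA /= perm_cons.
Qed.

Lemma ptree_iso_refl t : ptree_iso t t.
Proof.
elim/ptree_size_ind: t => a s IH; apply: (PIso a (perm_refl s)).
elim: s IH => [|t s IHs] IH; constructor; first exact/IH/mem_head.
by apply: IHs => u us; apply: IH; rewrite inE us orbT.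
Qed.

Lemma Forall2_flip (A B : Type) (r : A -> B -> Prop) u s :
  List.Forall2 r u s -> List.Forall2 (fun y x => r x y) s u.
Proof. by elim=> [|x y u' s' rxy _ IH]; constructor. Qed.

Lemma ptree_iso_sym t t' : ptree_iso t t' -> ptree_iso t' t.
Proof.
elim/ptree_size_ind: t t' => a s IH t' h.
inversion h as [? ? u s' psu us' e1 e2]; subst.
have [v pv sv] := Forall2_perm (etrans (perm_sym _ _) psu) us'.
apply: (PIso a pv); apply: Forall2_flip.
elim: sv IH {h psu} => [|x y s1 w rxy _ IHv] IH; constructor.
  by apply: IH => //; apply: mem_head.
by apply: IHv => z zs; apply: IH; rewrite inE zs orbT.
Qed.

Lemma ptree_iso_trans t1 t2 t3 :
  ptree_iso t1 t2 -> ptree_iso t2 t3 -> ptree_iso t1 t3.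
Proof.
elim/ptree_size_ind: t1 t2 t3 => a s IH t2 t3 h12 h23.
inversion h12 as [? ? u s2 psu us2 e1 e2]; subst.
inversion h23 as [? ? v s3 psv vs3 e1 e2]; subst.
have [w puw vw] := Forall2_perm psv (Forall2_flip us2).
have psw := perm_trans psu puw.
apply: (PIso a psw).
have ws x : x \in w -> x \in s by rewrite (perm_mem psw).
elim: vw s3 vs3 ws {h12 h23 psw puw psv} => [|y x v' w' rxy _ IHv] s3 vs3 ws;
  inversion vs3 as [|? z ? s3' ryz vs3' e1 e2]; subst; constructor.
  by apply: IH rxy ryz; apply/ws/mem_head.
by apply: IHv => // z' zw; apply: ws; rewrite inE zw orbT.
Qed.

Lemma psize_iso t t' : ptree_iso t t' -> psize t = psize t'.
Proof.
elim/ptree_size_ind: t t' => a s IH t' h.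
inversion h as [? ? u s' psu us' e1 e2]; subst => /=.
rewrite (perm_sumn (perm_map _ psu)); congr S.
have us x : x \in u -> x \in s by rewrite (perm_mem psu).
elim: us' us => //= x y u' s0 rxy _ IHu us; congr addn.
  by apply: IH rxy; apply/us/mem_head.
by apply: IHu => z zu; apply: us; rewrite inE zu orbT.
Qed.

Lemma proot_iso t t' : ptree_iso t t' -> proot t = proot t'.
Proof. by case. Qed.

Definition ptree_isob (t t' : ptree Omega) : bool := `[< ptree_iso t t' >].

Lemma ptree_isob_refl : reflexive ptree_isob.
Proof. by move=> t; apply/asboolP/ptree_iso_refl. Qed.

Lemma ptree_isob_sym : symmetric ptree_isob.
Proof. by move=> t t'; apply/asboolP/asboolP; apply: ptree_iso_sym. Qed.

Lemma ptree_isob_trans : transitive ptree_isob.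
Proof.
by move=> t2 t1 t3 /asboolP h12 /asboolP h23; apply/asboolP/ptree_iso_trans/h23.
Qed.

Canonical ptree_iso_equiv :=
  EquivRel ptree_isob ptree_isob_refl ptree_isob_sym ptree_isob_trans.
End Planar.

(* Isomorphism classes of (nonempty, non-planar) Omega-decorated rooted trees. *)
Definition tree (Omega : Type) : Type := {eq_quot (@ptree_iso_equiv Omega)}.
HB.instance Definition _ (Omega : Type) := Choice.on (tree Omega).
HB.instance Definition _ (Omega : Type) := EqQuotient.on (tree Omega).

(* A forest is a finite multiset of trees; [mone] is the empty forest and
   [mmul] is disjoint union. *)
Notation forest Omega := {cmonom (tree Omega)}.

(* The commutative algebra freely generated by trees: the monoid algebra of
   forests, i.e. polynomials whose indeterminates are the trees. *)
Notation falg R Omega := {malg R[forest Omega]}.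

Section Forests.
Variable Omega : Type.
Implicit Types (T : tree Omega) (F : forest Omega) (s : seq (tree Omega)).

(* The trees of a forest, listed with multiplicity (in an arbitrary order). *)
Definition trees F : seq (tree Omega) :=
  flatten [seq nseq (F T) T | T <- finsupp F].

Definition forest_of s : forest Omega := \big[mmul/mone]_(T <- s) ucm T.

Definition tree_size T : nat := psize (repr T).

Definition forest_size F : nat := (\sum_(T <- trees F) tree_size T)%N.

(* B_+^a on basis elements, with its inverse T = B_+^(troot T) (tchildren T). *)
Definition graft (a : Omega) F : tree Omega :=
  \pi_(tree Omega) (PNode a [seq repr T | T <- trees F]).

Definition troot T : Omega := proot (repr T).

Definition tchildren T : forest Omega :=
  forest_of [seq \pi_(tree Omega) t | t <- pchildren (repr T)].

Lemma count_trees F T : count_mem T (trees F) = F T.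
Proof.
rewrite /trees count_flatten -map_comp sumnE big_map.
under eq_bigr => t _ do rewrite /= count_nseq /=.
case: (mdomP F T) => [Tin|Tout].
  rewrite (big_fsetD1 T) //= eqxx mul1n big_seq big1 ?addn0 // => t.
  by rewrite in_fsetD1 => /andP[/negPf->].
rewrite big_seq big1 // => t tin; case: eqP => // tT.
by rewrite tT (negPf Tout) in tin.
Qed.

Lemma forest_ofE s T : forest_of s T = count_mem T s.
Proof.
rewrite /forest_of; elim: s => [|t s IH]; first by rewrite big_nil cm1.
by rewrite big_cons cmM IH cmU.
Qed.

Lemma trees_forest_of s : perm_eq (trees (forest_of s)) s.
Proof. by apply/allP => T _ /=; rewrite count_trees forest_ofE. Qed.

Lemma treesK : cancel trees forest_of.
Proof. by move=> F; apply/eqP/cmP => T; rewrite forest_ofE count_trees. Qed.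

Lemma forest_of_perm s s' : perm_eq s s' -> forest_of s = forest_of s'.
Proof. by move=> p; apply/eqP/cmP => T; rewrite !forest_ofE (permP p). Qed.

Lemma forest_size_of s :
  forest_size (forest_of s) = (\sum_(T <- s) tree_size T)%N.
Proof. by rewrite /forest_size (perm_big _ (trees_forest_of s)). Qed.

Lemma forest_of1 T : forest_of [:: T] = ucm T.
Proof. by rewrite /forest_of big_seq1. Qed.

Lemma trees0 : trees mone = [::].
Proof.
by apply: perm_nilP; have := trees_forest_of [::]; rewrite /forest_of big_nil.
Qed.

Lemma treesU T : trees (ucm T) = [:: T].
Proof. by rewrite -forest_of1; apply/perm_small_eq/trees_forest_of. Qed.

Lemma forest_sizeU T : forest_size (ucm T) = tree_size T.
Proof. by rewrite /forest_size treesU big_seq1. Qed.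

Lemma pi_iso (t t' : ptree Omega) :
  ptree_iso t t' <-> \pi_(tree Omega) t = \pi_(tree Omega) t'.
Proof.
split=> [h|h]; first by apply/eqquotP/asboolP.
by apply/asboolP; move/eqquotP: h.
Qed.

Lemma repr_pi_iso t : ptree_iso (repr (\pi_(tree Omega) t)) t.
Proof. by apply/pi_iso; rewrite reprK. Qed.

Lemma tree_size_pi t : tree_size (\pi_(tree Omega) t) = psize t.
Proof. exact/psize_iso/repr_pi_iso. Qed.

Lemma tree_sizeE T : tree_size T = (forest_size (tchildren T)).+1.
Proof.
rewrite forest_size_of big_map [LHS]/tree_size; case: (repr T) => a s /=.
by rewrite sumnE big_map; under [in RHS]eq_bigr do rewrite tree_size_pi.
Qed.

Lemma tree_size_gt0 T : (0 < tree_size T)%N.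
Proof. by rewrite tree_sizeE. Qed.

Lemma tchildren_pi t :
  tchildren (\pi_(tree Omega) t) =
  forest_of [seq \pi_(tree Omega) u | u <- pchildren t].
Proof.
rewrite /tchildren; have := repr_pi_iso t; move: (repr _) => t' h.
case: h => a s u s' psu us' /=.
rewrite (forest_of_perm (perm_map _ psu)); congr forest_of.
elim: us' => //= x y u' s0 rxy _ ->; congr cons.
exact/pi_iso.
Qed.

Lemma troot_graft a F : troot (graft a F) = a.
Proof.
by rewrite /troot /graft (proot_iso (repr_pi_iso _)).
Qed.

Lemma tchildren_graft a F : tchildren (graft a F) = F.
Proof.
rewrite tchildren_pi /= -map_comp -[RHS]treesK; congr forest_of.
by rewrite -[RHS]map_id; apply: eq_map => T /=; rewrite reprK.
Qed.

Lemma graftK T : graft (troot T) (tchildren T) = T.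
Proof.
rewrite -[RHS]reprK; apply/pi_iso; rewrite /troot /tchildren.
case: (repr T) => a s /=.
have p := perm_map repr (trees_forest_of [seq \pi_(tree Omega) t | t <- s]).
apply: (PIso a p); rewrite -map_comp.
by elim: s {p} => [|t s IH] /=; constructor => //; apply: repr_pi_iso.
Qed.

Lemma ltn_add_pred (a b p q m n : nat) :
  (a + p.-1 <= m -> b + q.-1 <= n -> 0 < p -> 0 < q -> 2 < p + q ->
   a + b < m + n)%N.
Proof. lia. Qed.

Lemma tree_size_leq s T :
  T \in s -> (tree_size T + (size s).-1 <= \sum_(t <- s) tree_size t)%N.
Proof.
move=> Ts; rewrite (perm_big _ (perm_to_rem Ts)) big_cons /= leq_add2l.
rewrite -(size_rem Ts) -sum1_size.
by apply: leq_sum => t _; apply: tree_size_gt0.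
Qed.
End Forests.

(* A forest as a basis vector, and concatenation, i.e. the product of the
   algebra of forests. They are locked only to keep unification from unfolding
   the monoid algebra. *)
HB.lock Definition basis (R : realType) (Omega : Type) (F : forest Omega) :
  falg R Omega := << F >>.
Arguments basis {R Omega} F.

HB.lock Definition concat (R : realType) (Omega : Type) (x y : falg R Omega) :
  falg R Omega := x * y.

Arguments concat {R Omega} x y.

Section Shuffle.
Variables (R : realType) (Omega : Type).
Implicit Types (F : forest Omega) (x y : falg R Omega).

Definition lin_ext (phi : forest Omega -> falg R Omega) x : falg R Omega :=
  \sum_(F <- msupp x) x@_F *: phi F.

Definition Bplus (a : Omega) : falg R Omega -> falg R Omega :=
  lin_ext (fun F => basis (ucm (graft a F))).

Variables (lam : R) (op : option (Omega -> Omega -> Omega)).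

(* One step of the recursion defining the shuffle of two forests; [rec] is
   applied to pairs with strictly fewer vertices. Without a product on Omega
   ([op = None]) the weighted term is absent. *)
Definition shuffle_step (rec : forest Omega -> forest Omega -> falg R Omega)
    F F' : falg R Omega :=
  match trees F, trees F' with
  | [::], _ => basis F'
  | _, [::] => basis F
  | [:: T], [:: t] =>
      Bplus (troot T) (rec (tchildren T) (ucm t))
      + Bplus (troot t) (rec (ucm T) (tchildren t))
      + (if op is Some m
         then lam *: Bplus (m (troot T) (troot t)) (rec (tchildren T) (tchildren t))
         else 0)
  | s, s' =>
      (size s * size s')%:R^-1 *:
        \sum_(T <- s) \sum_(t <- s')
          concat (concat (rec (ucm T) (ucm t)) (basis (forest_of (rem T s))))
          (basis (forest_of (rem t s')))
  end.

Fixpoint shuffle_rec (n : nat) F F' : falg R Omega :=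
  if n is n'.+1 then shuffle_step (shuffle_rec n') F F' else 0.

(* The number of recursive calls is bounded by the number of vertices. *)
Definition shuffle_forest F F' : falg R Omega :=
  shuffle_rec (forest_size F + forest_size F').+1 F F'.

Definition shuffle x y : falg R Omega :=
  lin_ext (fun F => lin_ext (shuffle_forest F) y) x.

Lemma lin_ext_basis phi F : lin_ext phi (basis F) = phi F.
Proof.
rewrite /lin_ext basis.unlock msuppU oner_eq0 big_seq_fset1 mcoeffUU.
by rewrite scale1r.
Qed.

Lemma shuffle_basis F F' : shuffle (basis F) (basis F') = shuffle_forest F F'.
Proof. by rewrite /shuffle !lin_ext_basis. Qed.

Lemma eq_shuffle_step rec1 rec2 F F' :
  (forall G G',
     (forest_size G + forest_size G' < forest_size F + forest_size F')%N ->
     rec1 G G' = rec2 G G') ->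
  shuffle_step rec1 F F' = shuffle_step rec2 F F'.
Proof.
rewrite /shuffle_step /(forest_size F) /(forest_size F').
move: (trees F) (trees F') => s s' eq_rec.
have eq_sum : (0 < size s)%N -> (0 < size s')%N -> (2 < size s + size s')%N ->
    \sum_(T <- s) \sum_(t <- s')
      concat (concat (rec1 (ucm T) (ucm t)) (basis (forest_of (rem T s))))
          (basis (forest_of (rem t s'))) =
    \sum_(T <- s) \sum_(t <- s')
      concat (concat (rec2 (ucm T) (ucm t)) (basis (forest_of (rem T s))))
          (basis (forest_of (rem t s'))).
  move=> s_gt0 s'_gt0 ss'; apply: eq_big_seq => T Ts.
  apply: eq_big_seq => t ts'; rewrite eq_rec // !forest_sizeU.
  exact: ltn_add_pred (tree_size_leq Ts) (tree_size_leq ts') s_gt0 s'_gt0 ss'.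
case: s eq_rec eq_sum => [|T [|T2 s]] eq_rec eq_sum; first by [].
  case: s' eq_rec eq_sum => [|t [|t2 s']] eq_rec eq_sum; first by [].
    move: eq_rec {eq_sum}; rewrite !big_seq1 => eq_rec.
    rewrite (eq_rec (tchildren T) (ucm t)); last first.
      by rewrite forest_sizeU (tree_sizeE T) addSn.
    rewrite (eq_rec (ucm T) (tchildren t)); last first.
      by rewrite forest_sizeU (tree_sizeE t) addnS.
    case: op => [m|]; last by [].
    rewrite (eq_rec (tchildren T) (tchildren t)); first by [].
    by rewrite (tree_sizeE T) (tree_sizeE t) addSn addnS ltnS leqW.
  by rewrite (eq_sum isT isT isT).
case: s' eq_rec eq_sum => [|t s'] eq_rec eq_sum; first by [].
by rewrite eq_sum //= addSn addnS.
Qed.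

Lemma shuffle_rec_fuel n m F F' :
  (forest_size F + forest_size F' < n)%N ->
  (forest_size F + forest_size F' < m)%N ->
  shuffle_rec n F F' = shuffle_rec m F F'.
Proof.
elim: n m F F' => [|n IH] m F F'; first by rewrite ltn0.
case: m => [|m]; first by rewrite ltn0.
rewrite !ltnS => le_n le_m; apply: eq_shuffle_step => G G' lt_G.
by apply: IH; [exact: leq_trans lt_G le_n|exact: leq_trans lt_G le_m].
Qed.

Lemma shuffle_forestE F F' :
  shuffle_forest F F' = shuffle_step shuffle_forest F F'.
Proof.
apply: eq_shuffle_step => G G' lt_G; exact: shuffle_rec_fuel.
Qed.

(* The three clauses of the recursive definition. *)
Lemma shuffle_forest0l F : shuffle_forest mone F = basis F.
Proof. by rewrite shuffle_forestE /shuffle_step trees0. Qed.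

Lemma shuffle_forest0r F : shuffle_forest F mone = basis F.
Proof.
rewrite shuffle_forestE /shuffle_step trees0.
case E: (trees F) => [|T [|T2 s]]; [|by []..].
by rewrite -(treesK F) E /forest_of big_nil.
Qed.

(* [rem] removes one occurrence, so the double sum ranges over the positions
   i <= k and j <= n. *)
Lemma shuffle_forests (s s' : seq (tree Omega)) :
  (0 < size s)%N -> (0 < size s')%N -> (2 < size s + size s')%N ->
  shuffle_forest (forest_of s) (forest_of s') =
  (size s * size s')%:R^-1 *:
    \sum_(T <- s) \sum_(t <- s')
      concat (concat (shuffle_forest (ucm T) (ucm t)) (basis (forest_of (rem T s))))
          (basis (forest_of (rem t s'))).
Proof.
move=> s_gt0 s'_gt0 ss'; rewrite shuffle_forestE.
have ps := trees_forest_of s; have ps' := trees_forest_of s'.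
transitivity ((size (trees (forest_of s)) * size (trees (forest_of s')))%:R^-1 *:
  \sum_(T <- trees (forest_of s)) \sum_(t <- trees (forest_of s'))
      concat (concat (shuffle_forest (ucm T) (ucm t))
                (basis (forest_of (rem T (trees (forest_of s))))))
        (basis (forest_of (rem t (trees (forest_of s')))))).
  rewrite /shuffle_step; have := perm_size ps'; have := perm_size ps.
  case: (trees _) => [|T [|T2 u]]; case: (trees _) => [|t [|t2 u']] //=; lia.
rewrite (perm_size ps) (perm_size ps') (perm_big _ ps) /=; congr (_ *: _).
apply: eq_bigr => T _; rewrite (perm_big _ ps') /=; apply: eq_bigr => t _.
rewrite (@forest_of_perm _ (rem T _) (rem T s)).
  rewrite (@forest_of_perm _ (rem t _) (rem t s')) //.
  by apply/permP => p; rewrite !count_rem (perm_mem ps') (permP ps').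
by apply/permP => p; rewrite !count_rem (perm_mem ps) (permP ps).
Qed.

Lemma shuffle_trees (a a' : Omega) (f f' : forest Omega) :
  shuffle_forest (ucm (graft a f)) (ucm (graft a' f')) =
  Bplus a (shuffle_forest f (ucm (graft a' f')))
  + Bplus a' (shuffle_forest (ucm (graft a f)) f')
  + (if op is Some m then lam *: Bplus (m a a') (shuffle_forest f f') else 0).
Proof.
by rewrite shuffle_forestE /shuffle_step !treesU !troot_graft !tchildren_graft.
Qed.
End Shuffle.

(* No associativity is required of [mul]. *)
Record comm_unital_nonassoc_algebra (R : nzRingType) (V : lmodType R)
    (mul : V -> V -> V) (one : V) : Prop := {
  mul_bilinear : @bilinear_for R V V V *:%R *:%R mul;
  mul_comm : commutative mul;
  mul_unitl : left_id one mul;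
  mul_unitr : right_id one mul
}.

(* Main.v *)
Require Import Defs.
From mathcomp Require Import all_boot all_order all_algebra finmap.
From mathcomp Require Import reals zify.
From mathcomp.multinomials Require Import monalg.
Import GRing.Theory.
Local Open Scope ring_scope.

(** The shuffle is the bilinear extension of a product of forests, so bilinearity
    holds by construction, and commutativity and the unit laws reduce to pairs
    of forests. On forests, the empty forest is neutral by the first clause of
    the recursion. Commutativity follows by induction on the total number of
    vertices, because each clause is symmetric: for two trees, exchanging the
    arguments exchanges the first two terms and replaces the root decoration
    [m a a'] of the third by [m a' a]; for two forests, it exchanges the two
    summations and the two concatenated remainders. The third term for two trees
    is where commutativity of the product of decorations enters
    ([shuffle_forestC]). *)

(** Stated over an arbitrary index type and ring so that coefficients are
    compared without unfolding the forests and the real numbers. *)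
Lemma malg_basis (K : choiceType) (A : nzRingType) (g : {malg A[K]}) :
  g = \sum_(k <- msupp g) g@_k *: << k >>.
Proof.
rewrite [LHS]monalgE; apply: eq_bigr => k _; apply/malgP => k'.
by rewrite mcoeffZ !mcoeffU mulrnAr mulr1.
Qed.

Section LinearExtension.
Variables (R : realType) (Omega : Type).
Implicit Types (phi : forest Omega -> falg R Omega) (x y : falg R Omega).

(** Summing over any finite set that contains the support lets elements with
    different supports be compared term by term. *)
Lemma lin_extEw phi x (d : {fset forest Omega}) :
  (msupp x `<=` d)%fset -> lin_ext phi x = \sum_(F <- d) x@_F *: phi F.
Proof.
move=> xd; apply: big_fset_incl => // F _ /mcoeff_outdom ->.
by rewrite scale0r.
Qed.

Lemma lin_ext_linear phi : linear (lin_ext phi).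
Proof.
move=> c x y; pose d := (msupp x `|` msupp y)%fset.
have xd : (msupp x `<=` d)%fset by apply: fsubsetUl.
have yd : (msupp y `<=` d)%fset by apply: fsubsetUr.
have zd : (msupp (c *: x + y) `<=` d)%fset.
  apply: fsubset_trans (msuppD_le _ _) _.
  by apply: fsetSU; apply: msuppZ_le.
rewrite (lin_extEw phi _ d xd) (lin_extEw phi _ d yd) (lin_extEw phi _ d zd).
rewrite scaler_sumr -big_split; apply: eq_bigr => F _.
by rewrite mcoeffD mcoeffZ scalerDl scalerA.
Qed.

Lemma eq_lin_ext phi psi x : phi =1 psi -> lin_ext phi x = lin_ext psi x.
Proof. by move=> e; apply: eq_bigr => F _; rewrite e. Qed.

Lemma lin_ext_id x : lin_ext basis x = x.
Proof. by rewrite /lin_ext basis.unlock [RHS]malg_basis. Qed.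

Lemma lin_ext_comb c phi psi x :
  lin_ext (fun F => c *: phi F + psi F) x = c *: lin_ext phi x + lin_ext psi x.
Proof.
rewrite /lin_ext scaler_sumr -big_split; apply: eq_bigr => F _ /=.
by rewrite scalerDr !scalerA [_ * c]mulrC.
Qed.

Lemma lin_ext_exchange (phi : forest Omega -> forest Omega -> falg R Omega) x y :
  lin_ext (fun F => lin_ext (phi F) y) x =
  lin_ext (fun G => lin_ext (phi^~ G) x) y.
Proof.
transitivity (\sum_(F <- msupp x) \sum_(G <- msupp y) (x@_F * y@_G) *: phi F G).
  by apply: eq_bigr => F _; rewrite scaler_sumr; apply: eq_bigr => G _; rewrite scalerA.
rewrite exchange_big; apply: eq_bigr => G _; rewrite scaler_sumr.
by apply: eq_bigr => F _; rewrite scalerA mulrC.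
Qed.

End LinearExtension.

Section Shuffle.
Variables (R : realType) (Omega : Type) (lam : R).
Variable op : option (Omega -> Omega -> Omega).

Lemma shuffle_linear_r (x : falg R Omega) : linear (shuffle lam op x).
Proof.
move=> c u v; rewrite -[RHS]lin_ext_comb.
by apply: eq_lin_ext => F; apply: lin_ext_linear.
Qed.

Lemma shuffle_bilinear :
  @bilinear_for R (falg R Omega) (falg R Omega) (falg R Omega) *:%R *:%R
    (shuffle lam op).
Proof.
split=> [y|x] c u v; first exact: lin_ext_linear.
exact: shuffle_linear_r.
Qed.

Lemma shuffle_unitl : left_id (basis mone) (shuffle lam op).
Proof.
move=> x; rewrite /shuffle lin_ext_basis -[RHS]lin_ext_id.
exact/eq_lin_ext/shuffle_forest0l.
Qed.

Lemma concatAC (x y z : falg R Omega) :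
  concat (concat x y) z = concat (concat x z) y.
Proof. by rewrite concat.unlock; apply: (@mulrAC (falg R Omega)). Qed.

Hypothesis opC : if op is Some m then commutative m else True.

(** Induction on the total number of vertices. The recursive calls made by the
    two sides are on the same pairs of smaller forests, with the arguments
    exchanged. *)
Lemma shuffle_forestC F F' :
  shuffle_forest lam op F F' = shuffle_forest lam op F' F.
Proof.
(* Only the clauses of the recursion are kept: unification would otherwise
   unfold the recursive definition. *)
move: (shuffle_forest0l lam op) (shuffle_forest0r lam op).
move: (shuffle_forests lam op) (shuffle_trees lam op).
move: (shuffle_forest lam op) => sh sh_forests sh_trees sh0l sh0r.
have [n] := ubnP (forest_size F + forest_size F').
elim: n F F' => [F F'|n IH F F']; first by rewrite ltn0.
rewrite ltnS => le_n.
have {IH le_n} IH (G G' : forest Omega) :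
    (forest_size G + forest_size G' < forest_size F + forest_size F')%N ->
    sh G G' = sh G' G.
  by move=> lt_G; apply: IH; apply: leq_trans lt_G le_n.
rewrite -(treesK F) -(treesK F').
have [/size0nil ->|s_gt0] := posnP (size (trees F)).
  by rewrite [forest_of [::]]big_nil sh0l sh0r.
have [/size0nil ->|s'_gt0] := posnP (size (trees F')).
  by rewrite [forest_of [::]]big_nil sh0l sh0r.
(* Both forests are nonempty here, so a total of at most 2 trees means two
   single trees. *)
have [lt2|le2] := ltnP 2 (size (trees F) + size (trees F')).
  rewrite (sh_forests _ _ s_gt0 s'_gt0 lt2).
  rewrite (sh_forests _ _ s'_gt0 s_gt0); last by rewrite addnC.
  rewrite mulnC exchange_big /=; congr (_ *: _).
  apply: eq_big_seq => t ts'; apply: eq_big_seq => T Ts.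
  rewrite concatAC IH // !forest_sizeU.
  exact: ltn_add_pred (tree_size_leq Ts) (tree_size_leq ts') s_gt0 s'_gt0 lt2.
have sT : size (trees F) = 1%N by lia.
have st : size (trees F') = 1%N by lia.
move: IH sT st; rewrite /forest_size.
case: (trees F) => [|T [|? ?]] //; case: (trees F') => [|t [|? ?]] // IH _ _.
rewrite !forest_of1; move: IH; rewrite !big_seq1 => IH.
have {IH} IH G G' :
    (forest_size G + forest_size G' < tree_size T + tree_size t)%N ->
    sh G G' = sh G' G by apply: IH.
rewrite -(graftK T) -(graftK t) !sh_trees !graftK.
rewrite (IH (tchildren T)); last by rewrite forest_sizeU (tree_sizeE T) addSn.
rewrite (IH (ucm T)); last by rewrite forest_sizeU (tree_sizeE t) addnS.
apply: congr2; first exact: addrC.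
case: op opC IH => [m mC|//] IH.
rewrite mC (IH (tchildren T) (tchildren t)); first by [].
by rewrite (tree_sizeE T) (tree_sizeE t) addSn addnS ltnS leqW.
Qed.

Lemma shuffleC : commutative (shuffle lam op).
Proof.
move=> x y.
apply: etrans (lin_ext_exchange _ _ (shuffle_forest lam op) x y) _.
by apply: eq_lin_ext => F; apply: eq_lin_ext => G; apply: shuffle_forestC.
Qed.

Lemma shuffle_unital_comm_algebra :
  comm_unital_nonassoc_algebra (shuffle lam op) (basis mone).
Proof.
split; [exact: shuffle_bilinear|exact: shuffleC|exact: shuffle_unitl|].
by move=> x; rewrite shuffleC shuffle_unitl.
Qed.

End Shuffle.

Theorem proposition5p4 (R : realType) :
  (forall (lam : R) (Omega : Type) (op : Omega -> Omega -> Omega),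
     lam != 0 -> associative op -> commutative op ->
     comm_unital_nonassoc_algebra
       (@shuffle R Omega lam (Some op)) (@basis R Omega mone))
  /\
  (forall Omega : Type,
     comm_unital_nonassoc_algebra
       (@shuffle R Omega 0 None) (@basis R Omega mone)).
Proof.
split=> [lam Omega op _ _ opC|Omega].
  exact: (shuffle_unital_comm_algebra R Omega lam (Some op) opC).
exact: (shuffle_unital_comm_algebra R Omega 0 None I).
Qed.
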